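(* Let $n\ge 2$, let $a_1,\dots,a_n>0$ be real numbers and let $w_1,\dots,w_n>0$ be weights with $\sum_{i=1}^n w_i=1$. Let $i_0$ be an index such that $\dfrac{a_{i_0}}{w_{i_0}}=\min\left\{\dfrac{a_1}{w_1},\dots,\dfrac{a_n}{w_n}\right\}$. Then the weighted harmonic mean $H_w=H_w(a_1,\dots,a_n)$ satisfies $$H_w<\frac{a_{i_0}}{w_{i_0}}\le\frac{a_i}{w_i},\qquad i=1,\dots,n.$$
   Context: The weighted harmonic mean of $a_1,\dots,a_n>0$ with weights $w_1,\dots,w_n>0$, $\sum_i w_i=1$, is $H_w(a_1,\dots,a_n)=\dfrac{1}{\sum_{i=1}^n w_i/a_i}$. *)

(* Defs.v *)
From mathcomp Require Import all_boot all_order all_algebra.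
From mathcomp Require Import reals.

Set Implicit Arguments.
Unset Strict Implicit.
Unset Printing Implicit Defensive.

Import Order.TTheory GRing.Theory Num.Theory.

Local Open Scope ring_scope.

Definition wharmonic_mean (R : realType) (n : nat) (w a : 'I_n -> R) : R :=
  1 / \sum_(i < n) w i / a i.

(* min {x_1, ..., x_n} for a nonempty family. A finite minimum has no neutral
   element in R, so the iteration starts from x j, which is itself a member of
   the family; the value therefore does not depend on the index j. *)
Definition family_min (R : realType) (n : nat) (j : 'I_n) (x : 'I_n -> R) : R :=
  \big[Num.min/x j]_(i < n) x i.

(* Main.v *)
Require Import Defs.
From mathcomp Require Import all_boot all_order all_algebra.
From mathcomp Require Import reals.

Import Order.TTheory GRing.Theory Num.Theory.

Local Open Scope ring_scope.

(** The reciprocal of the weighted harmonic mean is the sum of the positive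
    terms [w i / a i], and the reciprocal of [a i0 / w i0] is one of these
    terms.  With at least two indices, that term is strictly smaller than the
    whole sum ([lt_term_sum]); taking reciprocals reverses the inequality.  This
    bounds the mean by every ratio [a i / w i], and the choice of [i0] gives the
    sharpest of these bounds. *)

(** Any index other than [i0] contributes a positive amount to the sum, which
    makes the inequality strict. *)
Lemma lt_term_sum (R : numDomainType) (n : nat) (x : 'I_n -> R) (i0 : 'I_n) :
  (2 <= n)%N -> (forall i, 0 < x i) -> x i0 < \sum_(i < n) x i.
Proof.
move=> n_ge2 x_gt0.
have [j ji0] : exists j : 'I_n, j != i0.
  have : (0 < #|predC1 i0|)%N by rewrite cardC1 card_ord -subn1 subn_gt0.
  by case/card_gt0P=> j ji0; exists j.
rewrite (bigD1 i0) //= ltrDl (bigD1 j) //=.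
by rewrite ltr_wpDr // sumr_ge0 // => i _; exact: ltW.
Qed.

Lemma family_min_le (R : realType) (n : nat) (j : 'I_n) (x : 'I_n -> R)
    (i : 'I_n) :
  family_min j x <= x i.
Proof. exact: bigmin_le_cond. Qed.

Theorem lemma5 (R : realType) (n : nat) (n_ge2 : (2 <= n)%N)
    (a w : 'I_n -> R)
    (a_gt0 : forall i, 0 < a i)
    (w_gt0 : forall i, 0 < w i)
    (w_sum1 : \sum_(i < n) w i = 1)
    (i0 : 'I_n)
    (i0_min : a i0 / w i0 = family_min i0 (fun i => a i / w i)) :
  wharmonic_mean w a < a i0 / w i0 /\
  (forall i : 'I_n, a i0 / w i0 <= a i / w i).
Proof.
split; last by move=> i; rewrite i0_min; exact: family_min_le.
have wa_gt0 i : 0 < w i / a i by exact: divr_gt0.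
have lt_sum := lt_term_sum R n (fun i => w i / a i) i0 n_ge2 wa_gt0.
rewrite /wharmonic_mean div1r -[a i0 / w i0]invf_div.
by rewrite ltf_pV2 // posrE // (lt_trans (wa_gt0 i0) lt_sum).
Qed.
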